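(* Let $X$ be a uniformly convex Banach space and let $\{r_j\}_{j\ge1}$ be the sequence associated with $X$ by $r_1=1$ and, for every natural $j$, $r_{j+1}$ being the unique solution of $r_{j+1}\cdot\zeta^-_X(r_{j+1})=r_j$. Let $n,k$ be natural numbers with $1\le k\le n$. If $K_1,\ldots,K_n$ are convex sets in $X$ such that the unit ball $\mathbf{B}$ intersects $\bigcap_{j\in J}K_j$ for every $J\subset\{1,\dots,n\}$ of size $k$, then there is a point $x\in X$ such that \[ \operatorname{dist}(x,K_i)\le r_k\quad\text{for all } i\in\{1,\dots,n\}. \]
   Context: Banach spaces are real, of dimension at least $2$. $\mathbf{B}=\{x\in X:\|x\|\le1\}$ and $\operatorname{dist}(a,S)=\inf_{s\in S}\|a-s\|$. The modulus of convexity is $\delta_X(\varepsilon)=\inf\{1-\frac{\|x+y\|}{2}: x,y\in\mathbf{B},\ \|x-y\|\ge\varepsilon\}$, $\varepsilon\in[0,2]$; $X$ is uniformly convex if $\delta_X>0$ on $(0,2]$. For $x\ne0$, $y$ is quasi-orthogonal to $x$, written $y\urcorner x$, if there is a non-zero continuous linear functional $p$ with $p(x)=\|p\|\|x\|$ and $p(y)=0$ (equivalently, $\|x+\lambda y\|\ge\|x\|$ for all $\lambda\in\mathbb{R}$). The function $\zeta^-_X:[0,\infty)\to[0,\infty)$ is $\zeta^-_X(\varepsilon)=\inf\{\|x+\varepsilon y\|:\|x\|=\|y\|=1,\ y\urcorner x\}$. The sequence $\{r_j\}$ is well-defined. *)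

(* Defs.v *)
From HB Require Import structures.
From mathcomp Require Import all_boot all_order all_algebra.
From mathcomp Require Import all_classical all_reals all_analysis.
Import Order.TTheory GRing.Theory Num.Theory.
Import numFieldNormedType.Exports.

Set Implicit Arguments.
Unset Strict Implicit.
Unset Printing Implicit Defensive.

Local Open Scope classical_set_scope.
Local Open Scope ring_scope.

Section BanachGeometry.
Context {R : realType}.

Definition dim_ge2 (X : lmodType R) : Prop :=
  exists x y : X, forall a b : R, a *: x + b *: y = 0 -> a = 0 /\ b = 0.

Definition unit_ball (X : normedModType R) : set X := [set x | `|x| <= 1].

(* The infimum is real-valued, so this is the usual distance for [S !=set0]
   only ([inf set0 = 0]). *)
Definition dist (X : normedModType R) (a : X) (S : set X) : R :=
  inf [set `|a - s| | s in S].

Definition modulus_convexity (X : normedModType R) (eps : R) : R :=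
  inf [set t | exists x y : X, [/\ unit_ball x, unit_ball y,
                                  eps <= `|x - y| & t = 1 - `|x + y| / 2]].

Definition uniformly_convex (X : normedModType R) : Prop :=
  forall eps : R, 0 < eps -> eps <= 2 -> 0 < modulus_convexity X eps.

(* The dual norm; meaningful for continuous [p], as [sup] of an unbounded set
   is [0]. *)
Definition dual_norm (X : normedModType R) (p : {linear X -> R^o}) : R :=
  sup [set `|p z| | z in @unit_ball X].

Definition quasi_orthogonal (X : normedModType R) (y x : X) : Prop :=
  x != 0 /\
  exists p : {linear X -> R^o},
    [/\ continuous p, exists z, p z != 0,
        p x = dual_norm p * `|x| & p y = 0].

Definition zeta_minus (X : normedModType R) (eps : R) : R :=
  inf [set t | exists x y : X, [/\ `|x| = 1, `|y| = 1,
                                  quasi_orthogonal y x & t = `|x + eps *: y|]].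

(* [r j] is the j-th term for j >= 1; [r 0] is unconstrained. Solutions are
   sought in [0, +oo[, the domain of [zeta_minus]. *)
Definition associated_seq (X : normedModType R) (r : nat -> R) : Prop :=
  r 1%N = 1 /\
  forall j : nat, (1 <= j)%N ->
    unique (fun s : R => 0 <= s /\ s * zeta_minus X s = r j) (r j.+1).

End BanachGeometry.

Arguments unit_ball {R} X.

(* Main.v *)
Require Import Defs.
From HB Require Import structures.
From mathcomp Require Import all_boot all_order all_algebra.
From mathcomp Require Import all_classical all_reals all_analysis.
From mathcomp Require Import ring lra.
Import Order.TTheory GRing.Theory Num.Theory.
Import numFieldNormedType.Exports.
Local Open Scope classical_set_scope.
Local Open Scope ring_scope.

Set Implicit Arguments.
Unset Strict Implicit.
Unset Printing Implicit Defensive.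

(** The set of points within distance [rho := r k] of every [K i] turns out to be
    nonempty by a greedy argument. Suppose instead that from every point some
    [K i] is farther than [rho]. Start at the centre of the ball and build
    index sets [J]: take as [c] the point nearest to the origin in the
    intersection of the closures of the [K j], [j] in [J], then add to [J] an
    index [i] whose set is farther than [rho] from [c]. Uniform convexity and
    completeness provide these nearest points (lemma [nearest_point]).

    Passing from [c] to the next nearest point [c'] moves by [v := c' - c], of
    norm greater than [rho]. Since [c] is nearest, the norm does not drop below
    [`|c|] on the ray from [c] in the direction [v]; by Hahn-Banach there is a
    norming functional [p] of [c] with [0 <= p v]. Among the vectors of a given
    norm in the half-space [0 <= p] of the plane of [c] and [v], those of the
    kernel of [p] give the smallest sum with [c] ([norm_arc_ge]), and they are
    quasi-orthogonal to [c]. Hence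
      [`|c| * zeta_minus X (rho / `|c|) <= `|c'|]
    ([norm_add_ge_zeta_minus]).

    Put [s := rho / `|c|] and [s' := rho / `|c'|]. The inequality says
    [s' * zeta_minus X s <= s], and [s' <= s], so
    [s' * zeta_minus X s' <= s] because [zeta_minus] is nondecreasing. Comparing
    with [r j.+1 * zeta_minus X (r j.+1) = r j] gives, by induction on the
    number of steps [j], that [rho / `|c| < r j]. After [k] steps the
    intersection still meets the unit ball, so [`|c| <= 1] and
    [rho <= rho / `|c| < r k = rho], a contradiction. *)

(** * Sublinear functionals and the Hahn-Banach theorem *)

(** Only [<=] is asked in the homogeneity clause: applied to [t^-1] it gives the
    reverse inequality, and this form is the one that infima inherit directly. *)
Definition sublinear (R : realType) (X : lmodType R) (q : X -> R) : Prop :=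
  (forall x y, q (x + y) <= q x + q y) /\
  (forall (t : R) x, 0 < t -> q (t *: x) <= t * q x).

Lemma sublinear0 (R : realType) (X : lmodType R) (q : X -> R) :
  sublinear q -> q 0 = 0.
Proof.
move=> [qD qZ]; have := qD 0 0; have := qZ 2^-1 0 ltac:(lra).
by rewrite scaler0 addr0; lra.
Qed.

Lemma sublinearN_ge (R : realType) (X : lmodType R) (q : X -> R) (x : X) :
  sublinear q -> - q (- x) <= q x.
Proof.
move=> sq; have [qD _] := sq; have := qD x (- x).
by rewrite subrr sublinear0 //; lra.
Qed.

(** Every sublinear functional constructed below is an infimum of a family that
    is stable, up to decreasing the values, under the two operations. The lower
    bound [b] makes the real-valued infimum meaningful. *)
Lemma sublinear_inf (R : realType) (X : lmodType R) (I : Type) (D : set I)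
    (F : I -> X -> R) (b : X -> R) :
  D !=set0 -> (forall i x, D i -> b x <= F i x) ->
  (forall i j x y, D i -> D j -> exists2 k, D k & F k (x + y) <= F i x + F j y) ->
  (forall i (t : R) x, D i -> 0 < t ->
     exists2 k, D k & F k (t *: x) <= t * F i x) ->
  sublinear (fun x => inf [set F i x | i in D]).
Proof.
move=> [i0 Di0] bF FD FZ.
have Fne x : [set F i x | i in D] !=set0 by exists (F i0 x), i0.
have Flb x : has_lbound [set F i x | i in D].
  by exists (b x) => _ [i Di <-]; exact: bF.
split=> [x y|t x t0].
  apply/ler_addgt0Pr => e e0.
  have e20 : 0 < e / 2 by rewrite divr_gt0.
  have [_ [i Di <-] ix] := inf_adherent e20 (conj (Fne x) (Flb x)).
  have [_ [j Dj <-] jy] := inf_adherent e20 (conj (Fne y) (Flb y)).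
  have [k Dk kxy] := FD i j x y Di Dj.
  apply: (le_trans (y := F k (x + y))); last by lra.
  by apply: ge_inf => //; exists k.
rewrite -ler_pdivrMl //; apply: lb_le_inf => // _ [i Di <-].
have [k Dk kx] := FZ i t x Di t0.
rewrite ler_pdivrMl //; apply: le_trans kx.
by apply: ge_inf => //; exists k.
Qed.

(** Zorn's lemma on the sublinear functionals below [q], ordered downwards: all of
    them satisfy [- q (- x) <= s x], so a nonempty chain has a pointwise infimum,
    and that infimum is sublinear since two members of a chain are comparable. *)
Lemma sublinear_minimal (R : realType) (X : lmodType R) (q : X -> R) :
  sublinear q -> exists s : X -> R, [/\ sublinear s, forall x, s x <= q x &
    forall s', sublinear s' -> (forall x, s' x <= s x) -> s' = s].
Proof.
move=> sq.
pose T := {s : X -> R | `[< sublinear s /\ forall x, s x <= q x >]}.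
have TP (s : T) : sublinear (val s) /\ forall x, val s x <= q x.
  by have /asboolP := valP s.
pose le (s t : T) := `[< forall x, val t x <= val s x >].
have [|r s t /asboolP rs /asboolP st|s t /asboolP st /asboolP ts|A totA|s smin] :=
    @Zorn T le.
- by move=> s; apply/asboolP.
- by apply/asboolP => x; exact: le_trans (st x) (rs x).
- by apply: val_inj; apply/funext => x; apply/eqP; rewrite eq_le st ts.
- have [A0|] := pselect (A !=set0); last first.
    have Tq : `[< sublinear q /\ forall x, q x <= q x >] by apply/asboolP.
    by move=> A0; exists (exist _ q Tq) => s As; exfalso; apply: A0; exists s.
  pose g x := inf [set val s x | s in A].
  have lb (s : T) x : - q (- x) <= val s x.
    have [ss sleq] := TP s; apply: le_trans (sublinearN_ge x ss).
    by rewrite lerN2.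
  have sg : sublinear g.
    apply: (@sublinear_inf _ _ _ A (fun s : T => val s) (fun x => - q (- x))) => //.
      move=> s t x y As At.
      have [[sD _] _] := TP s; have [[tD _] _] := TP t.
      have [/asboolP st|/asboolP ts] := totA s t As At.
        by exists t => //; apply: le_trans (tD x y) _; rewrite lerD2r.
      by exists s => //; apply: le_trans (sD x y) _; rewrite lerD2l.
    by move=> s t x As t0; exists s => //; have [[_ sZ] _] := TP s; exact: sZ.
  have gle (s : T) x : A s -> g x <= val s x.
    move=> As; apply: ge_inf; last by exists s.
    by exists (- q (- x)) => _ [t At <-].
  have Tg : `[< sublinear g /\ forall x, g x <= q x >].
    apply/asboolP; split=> // x; have [s As] := A0.
    by apply: le_trans (gle s x As) _; have [_] := TP s.
  by exists (exist _ g Tg) => s As; apply/asboolP => x /=; exact: gle.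
- have [ss sleq] := TP s; exists (val s); split=> // s' ss' s'les.
  have Ts' : `[< sublinear s' /\ forall x, s' x <= q x >].
    by apply/asboolP; split=> // x; exact: le_trans (s'les x) (sleq x).
  have /= := smin (exist _ s' Ts').
  by move=> h; rewrite -h //; apply/asboolP.
Qed.

(** A minimal sublinear functional [s] is linear. For fixed [y], the functional
    [x |-> inf_(t >= 0) (s (x + t *: y) - t * s y)] is sublinear and below [s],
    hence equal to [s]; taking [t := 1] at [x := - y] yields [s (- y) <= - s y],
    and an odd sublinear functional is linear. *)
Lemma hahn_banach_sublinear (R : realType) (X : lmodType R) (q : X -> R) :
  sublinear q -> exists p : {linear X -> R^o}, forall x, p x <= q x.
Proof.
move=> /sublinear_minimal [s [ss sleq smin]].
have [sD sZ] := ss; have s0 := sublinear0 ss.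
have sN y : s (- y) = - s y.
  pose F (t : R) (x : X) : R := s (x + t *: y) - t * s y.
  have Fb (t : R) (x : X) : 0 <= t -> - s (- x) <= F t x.
    rewrite le_eqVlt => /predU1P[<-|t0]; rewrite /F.
      by rewrite scale0r addr0 mul0r subr0 sublinearN_ge.
    have := sD (x + t *: y) (- x); rewrite addrAC subrr add0r.
    have := sZ t^-1 (t *: y); rewrite invr_gt0 => /(_ t0).
    rewrite scalerA mulVf ?gt_eqF// scale1r ler_pdivlMl //; lra.
  pose s' (x : X) : R := inf [set F t x | t in [set t | 0 <= t]].
  have Flb (x : X) : has_lbound [set F t x | t in [set t | 0 <= t]].
    by exists (- s (- x)) => _ [t t0 <-]; exact: Fb.
  have ss' : sublinear s'.
    apply: (@sublinear_inf _ _ _ _ F (fun x => - s (- x))).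
    - by exists 0 => /=.
    - by move=> t x t0; exact: Fb.
    - move=> t u x z /= t0 u0; exists (t + u); first exact: addr_ge0.
      rewrite /F scalerDl mulrDl (addrACA x z).
      by rewrite [leRHS]addrACA -opprD lerD2r; exact: sD.
    - move=> t u x /= t0 u0; exists (u * t); first by rewrite mulr_ge0 // ltW.
      by rewrite /F -scalerA -scalerDr mulrBr mulrA lerD2r; exact: sZ.
  have es : s' = s.
    apply: smin => // x; apply: ge_inf => //; exists 0 => //=.
    by rewrite /F scale0r addr0 mul0r subr0.
  apply/eqP; rewrite eq_le; apply/andP; split; last first.
    by rewrite -[X in - s X <= _]opprK; exact: sublinearN_ge.
  rewrite -{1}es; apply: ge_inf => //; exists 1 => //=.
  by rewrite /F scale1r addNr s0 mul1r sub0r.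
have lin_s : linear (s : X -> R^o).
  have sZ0 (a : R) x : 0 < a -> s (a *: x) = a * s x.
    move=> a0; apply/eqP; rewrite eq_le sZ //=.
    have := sZ a (- x) a0; rewrite scalerN !sN mulrN; lra.
  have sZr a x : s (a *: x) = a * s x.
    have [a0|a0|->] := ltgtP a 0; [|exact: sZ0|by rewrite scale0r mul0r].
    by rewrite -[a]opprK scaleNr sN sZ0 ?oppr_gt0 // [RHS]mulNr.
  have sDe x y : s (x + y) = s x + s y.
    apply/eqP; rewrite eq_le sD /=.
    by have := sD (- x) (- y); rewrite -opprD !sN -opprD lerN2.
  by move=> a x y; rewrite sDe sZr.
pose linS := GRing.isLinear.Build R X R^o *:%R (s : X -> R^o) lin_s.
pose p : {linear X -> R^o} := HB.pack (s : X -> R^o) linS.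
by exists p.
Qed.

(** * Norming functionals and quasi-orthogonality *)

(** Dominate by
      [q x := inf_(s, t >= 0) (`|x + s *: c + t *: v| - s * `|c|)],
    which is bounded below because [s * `|c| <= `|s *: c + t *: v|] by the
    hypothesis. The values of the family at [(0, 0)], [(1, 0)] and [(0, 1)] show
    that [q] is below the norm, that [q (- c) <= - `|c|] and that
    [q (- v) <= 0]; any linear functional below [q] is then as required. *)
Lemma support_functional (R : realType) (X : normedModType R) (c v : X) :
  (forall t : R, 0 <= t -> `|c| <= `|c + t *: v|) ->
  exists p : {linear X -> R^o},
    [/\ forall x, p x <= `|x|, p c = `|c| & 0 <= p v].
Proof.
move=> cv.
pose D := [set u : R * R | 0 <= u.1 /\ 0 <= u.2].
pose F (u : R * R) (x : X) : R := `|x + (u.1 *: c + u.2 *: v)| - u.1 * `|c|.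
have Fb u x : D u -> - `|x| <= F u x.
  move=> [s0 t0]; rewrite /F.
  have sc : u.1 * `|c| <= `|u.1 *: c + u.2 *: v|.
    have [->|s_neq0] := eqVneq u.1 0; first by rewrite mul0r.
    have -> : u.1 *: c + u.2 *: v = u.1 *: (c + (u.1^-1 * u.2) *: v).
      by rewrite scalerDr scalerA mulrA divff // mul1r.
    by rewrite normrZ ger0_norm // ler_wpM2l // cv // mulr_ge0 // invr_ge0.
  have := ler_normB (x + (u.1 *: c + u.2 *: v)) x.
  by rewrite addrAC subrr add0r; lra.
have Flb x : has_lbound [set F u x | u in D].
  by exists (- `|x|) => _ [u Du <-]; exact: Fb.
have Fle u x : D u -> inf [set F u x | u in D] <= F u x.
  by move=> Du; apply: ge_inf => //; exists u.
have [|p pq] := @hahn_banach_sublinear R X (fun x => inf [set F u x | u in D]).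
  apply: (@sublinear_inf _ _ _ D F (fun x => - `|x|)).
  - by exists (0, 0); split.
  - by move=> u x; exact: Fb.
  - move=> u w x y [u1 u2] [w1 w2]; exists (u.1 + w.1, u.2 + w.2).
      by split; exact: addr_ge0.
    rewrite /F /= mulrDl opprD [leRHS]addrACA lerD2r.
    rewrite !scalerDl (addrACA (u.1 *: c)) (addrACA x).
    exact: ler_normD.
  - move=> u t x [u1 u2] t0; exists (t * u.1, t * u.2).
      by split; rewrite mulr_ge0 // ltW.
    rewrite /F /= -!scalerA -!scalerDr normrZ gtr0_norm //.
    by rewrite mulrBr mulrA.
have pF u x : D u -> p x <= F u x by move=> Du; apply: le_trans (pq x) (Fle _ _ Du).
have pN x : p x <= `|x|.
  have := pF (0, 0) x; rewrite /F /= !scale0r !addr0 mul0r subr0.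
  by apply; split.
exists p; split=> //.
  apply/eqP; rewrite eq_le pN /=.
  have : p (- c) <= - `|c|.
    have := pF (1, 0) (- c); rewrite /F /= scale1r scale0r addr0 addNr normr0.
    by rewrite mul1r sub0r; apply; split => //=.
  by rewrite linearN lerN2.
have : p (- v) <= 0.
  have := pF (0, 1) (- v); rewrite /F /= scale1r scale0r add0r addNr normr0.
  by rewrite mul0r subr0; apply; split => //=.
by rewrite linearN oppr_le0.
Qed.

Lemma norm_le_functional (R : realType) (X : normedModType R)
    (p : {linear X -> R^o}) :
  (forall x, p x <= `|x|) -> forall x, `|p x| <= `|x|.
Proof.
move=> pN x; rewrite ler_norml pN andbT lerNl.
by have := pN (- x); rewrite linearN normrN.
Qed.

Lemma quasi_orthogonal_of_support (R : realType) (X : normedModType R)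
    (p : {linear X -> R^o}) (x y : X) :
  (forall z, p z <= `|z|) -> `|x| = 1 -> p x = 1 -> p y = 0 ->
  quasi_orthogonal y x.
Proof.
move=> /norm_le_functional pN x1 px1 py0.
split; first by rewrite -normr_eq0 x1 oner_eq0.
have norm_p : dual_norm p = 1.
  apply/eqP; rewrite eq_le; apply/andP; split.
    apply: ge_sup; first by exists `|p x|, x => //; rewrite /unit_ball /= x1.
    by move=> _ [z z1 <-]; exact: le_trans (pN z) z1.
  apply: ub_le_sup; last first.
    by exists x; [rewrite /unit_ball /= x1|rewrite px1 normr1].
  by exists 1 => _ [z z1 <-]; exact: le_trans (pN z) z1.
exists p; split.
- apply: bounded_linear_continuous; apply/linear_boundedP.
  near=> r => z; apply: le_trans (pN z) _.
  by rewrite ler_peMl.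
- by exists x; rewrite px1 oner_eq0.
- by rewrite norm_p mul1r x1.
- exact: py0.
Unshelve. all: by end_near. Qed.

Lemma le_dual_norm (R : realType) (X : normedModType R)
    (p : {linear X -> R^o}) (z : X) :
  continuous p -> `|p z| <= dual_norm p * `|z|.
Proof.
move=> pc; have [->|z0] := eqVneq z 0.
  by rewrite linear0 !normr0 mulr0.
have zgt0 : 0 < `|z| by rewrite normr_gt0.
have /linear_boundedP pb := @continuous_linear_bounded _ _ _ 0 p (pc 0).
have [M Mp] : exists M : R, forall x, `|p x| <= M * `|x|.
  by near (pinfty_nbhs R) => M; exists M; near: M.
rewrite -ler_pdivrMr //; apply: ub_le_sup.
  exists `|M| => _ [w w1 <-]; apply: le_trans (Mp w) _.
  apply: (le_trans (y := `|M| * `|w|)); first by rewrite ler_wpM2r // ler_norm.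
  by rewrite ler_piMr.
exists (`|z|^-1 *: z).
  by rewrite /unit_ball /= normrZ normfV normr_id mulVf // gt_eqF.
by rewrite linearZ normrZ normfV normr_id mulrC.
Unshelve. all: by end_near. Qed.

(** The half of the metric characterization of quasi-orthogonality that follows
    from the existence of the functional. *)
Lemma quasi_orthogonal_norm_le (R : realType) (X : normedModType R) (x y : X)
    (t : R) :
  quasi_orthogonal y x -> `|x| <= `|x + t *: y|.
Proof.
move=> [x0 [p [pc [z pz] px py]]].
have p_gt0 : 0 < dual_norm p.
  have := le_trans _ (le_dual_norm z pc); move=> /(_ _ (lexx _)).
  have : 0 < `|p z| by rewrite normr_gt0.
  move=> h1 h2; have := lt_le_trans h1 h2.
  have zgt0 : 0 < `|z|.
    by rewrite normr_gt0; apply: contraNneq pz => ->; rewrite linear0.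
  by rewrite pmulr_lgt0.
rewrite -(ler_pM2l p_gt0) -px.
have -> : p x = p (x + t *: y) by rewrite linearD linearZ /= py scaler0 addr0.
by apply: le_trans (ler_norm _) _; exact: le_dual_norm.
Qed.

(** Convexity of the norm on a ray: [x + a *: w] lies on the segment from [x] to
    [x + b *: w], and [x] has the smaller norm of the two ends. *)
Lemma le_norm_along_ray (R : realType) (X : normedModType R) (x w : X)
    (a b : R) :
  0 <= a -> a <= b -> `|x| <= `|x + b *: w| -> `|x + a *: w| <= `|x + b *: w|.
Proof.
move=> a0 ab xb.
have [b0|b_neq0] := eqVneq b 0.
  by have -> : a = b by apply/eqP; rewrite eq_le ab b0 a0.
have b0 : 0 < b by rewrite lt_neqAle eq_sym b_neq0 (le_trans a0 ab).
have ab0 : 0 <= a / b by rewrite divr_ge0 // ltW.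
have ab1 : 0 <= 1 - a / b by rewrite subr_ge0 ler_pdivrMr // mul1r.
have -> : x + a *: w = (1 - a / b) *: x + (a / b) *: (x + b *: w).
  by rewrite scalerDr scalerA divfK // addrA -scalerDl subrK scale1r.
apply: le_trans (ler_normD _ _) _.
rewrite (normrZ _ x) (normrZ _ (x + _)) (ger0_norm ab0) (ger0_norm ab1).
have := ler_wpM2l ab1 xb; lra.
Qed.

(** * The function [zeta_minus] *)

Lemma zeta_minus_le_norm (R : realType) (X : normedModType R) (x y : X)
    (eps : R) :
  `|x| = 1 -> `|y| = 1 -> quasi_orthogonal y x ->
  zeta_minus X eps <= `|x + eps *: y|.
Proof.
move=> x1 y1 yx; apply: ge_inf; last by exists x, y.
by exists 0 => _ [z [w [_ _ _ ->]]].
Qed.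

Lemma zeta_minus_ge0 (R : realType) (X : normedModType R) (eps : R) :
  0 <= zeta_minus X eps.
Proof.
rewrite /zeta_minus; set S := [set t | _].
have [->|S0] := eqVneq S set0; first by rewrite inf0.
by apply: lb_le_inf; [exact/set0P|move=> _ [z [w [_ _ _ ->]]]].
Qed.

(** This settles the sum of [x] with [eps *: x], a vector that determines no
    direction in the kernel of a norming functional of [x]. *)
Lemma zeta_minus_le1D (R : realType) (X : normedModType R) (eps : R) :
  0 <= eps -> zeta_minus X eps <= 1 + eps.
Proof.
move=> eps0; rewrite {1}/zeta_minus; set S := [set t | _].
have [->|/set0P[_ [x [y [x1 y1 yx _]]]]] := eqVneq S set0.
  by rewrite inf0 addr_ge0.
apply: le_trans (zeta_minus_le_norm eps x1 y1 yx) _.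
by apply: le_trans (ler_normD _ _) _; rewrite normrZ x1 y1 mulr1 ger0_norm.
Qed.

Lemma zeta_minus_nondecreasing (R : realType) (X : normedModType R) (a b : R) :
  0 <= a -> a <= b -> zeta_minus X a <= zeta_minus X b.
Proof.
move=> a0 ab; rewrite {2}/zeta_minus; set S := [set t | _].
have [S0|/set0P S_neq0] := eqVneq S set0.
  rewrite S0 inf0 /zeta_minus (_ : [set t | _] = set0) ?inf0 //.
  rewrite -subset0 => t [x [y [x1 y1 yx _]]].
  have : S `|x + b *: y| by exists x, y.
  by rewrite S0.
apply: lb_le_inf => // _ [x [y [x1 y1 yx ->]]].
apply: le_trans (zeta_minus_le_norm a x1 y1 yx) _.
by apply: le_norm_along_ray => //; exact: quasi_orthogonal_norm_le.
Qed.

(** A monotonicity lemma for the circle of radius [eps * `|w|]: moving from [w]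
    towards [x] along it does not decrease the norm of the sum with [x].
    Write [y := alpha *: w + beta *: x]. The segment from [- x] to [eps *: y]
    crosses the line of [w] at [tau *: (eps *: w)] for
    [tau := alpha / (1 + eps * beta)]. If [1 <= tau], the claim follows from the
    growth of the norm on the ray from [x] in the direction [w]. Otherwise the
    crossing point lies on the segment from [0] to [eps *: w]; in the
    quadrilateral [- x, 0, eps *: y, eps *: w] the two diagonals are together at
    least as long as two opposite sides, and the segments [eps *: w], [eps *: y]
    issued from [0] have equal length. *)
Lemma norm_arc_ge (R : realType) (X : normedModType R) (x w : X)
    (eps alpha beta : R) :
  0 <= eps -> 0 <= alpha -> 0 <= beta ->
  (forall t, `|x| <= `|x + t *: w|) ->
  `|alpha *: w + beta *: x| = `|w| ->
  `|x + eps *: w| <= `|x + eps *: (alpha *: w + beta *: x)|.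
Proof.
move=> eps0 a0 b0 xw yw.
have eb1 : 1 <= 1 + eps * beta by rewrite lerDl mulr_ge0.
have eb0 : 0 < 1 + eps * beta by exact: lt_le_trans eb1.
set y := alpha *: w + beta *: x.
pose tau := alpha / (1 + eps * beta).
have tau0 : 0 <= tau by rewrite divr_ge0 // ltW.
have eyE : x + eps *: y = (1 + eps * beta) *: (x + (tau * eps) *: w).
  rewrite /y !scalerDr scalerDl scale1r !scalerA.
  have -> : (1 + eps * beta) * (tau * eps) = eps * alpha.
    by rewrite /tau; field; rewrite gt_eqF.
  by rewrite addrA addrAC.
have [tau1|tau1] := leP 1 tau.
  rewrite eyE normrZ ger0_norm; last exact: ltW.
  apply: (@le_trans _ _ `|x + (tau * eps) *: w|); last by rewrite ler_peMl.
  by apply: le_norm_along_ray => //; rewrite ler_peMl.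
pose m := (tau * eps) *: w.
have xm : `|x + m| + `|eps *: y - m| = `|x + eps *: y|.
  have -> : eps *: y - m = (eps * beta) *: (x + m).
    have -> : eps *: y - m = (x + eps *: y) - (x + m) by rewrite opprD addrACA subrr add0r.
    by rewrite eyE -/m scalerDl scale1r addrAC subrr add0r.
  rewrite eyE -/m !(normrZ _ (x + m)) (gtr0_norm eb0) ger0_norm ?mulr_ge0 //.
  by rewrite mulrDl mul1r.
have wm : `|m| + `|eps *: w - m| = `|eps *: w|.
  have -> : eps *: w - m = ((1 - tau) * eps) *: w.
    by rewrite /m -scalerBl mulrBl mul1r.
  have te0 : 0 <= tau * eps by exact: mulr_ge0.
  have te1 : 0 <= (1 - tau) * eps by rewrite mulr_ge0 // subr_ge0 ltW.
  rewrite !(normrZ _ w) (ger0_norm te0) (ger0_norm te1) (ger0_norm eps0).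
  by rewrite -mulrDl; congr (_ * _); ring.
have ew : `|eps *: w| = `|eps *: y| by rewrite (normrZ _ w) (normrZ _ y) -yw.
have t1 : `|x + eps *: w| <= `|x + m| + `|eps *: w - m|.
  by rewrite (le_trans _ (ler_normD _ _)) // addrA addrAC addrK.
have t2 : `|eps *: y| <= `|m| + `|eps *: y - m|.
  by rewrite (le_trans _ (ler_normD _ _)) // addrC addrNK.
apply: (le_trans t1); apply: (@le_trans _ _ (`|x + m| + `|eps *: y - m|)).
  by rewrite lerD2l -(lerD2l `|m|) wm ew.
by rewrite xm.
Qed.

(** The infimum defining [zeta_minus] ranges over the kernel of norming
    functionals; it also bounds the half-space where such a functional is
    nonnegative. Decomposing [y] along [x] and the kernel of [p] brings this to
    [norm_arc_ge]. *)
Lemma zeta_minus_le_supported (R : realType) (X : normedModType R)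
    (p : {linear X -> R^o}) (x y : X) (eps : R) :
  (forall z, p z <= `|z|) -> `|x| = 1 -> p x = 1 -> `|y| = 1 -> 0 <= p y ->
  0 <= eps -> zeta_minus X eps <= `|x + eps *: y|.
Proof.
move=> pN x1 px1 y1 py0 eps0.
pose w0 := y - p y *: x.
have pw0 : p w0 = 0 by rewrite /w0 linearB linearZ /= px1 /GRing.scale /= mulr1 subrr.
have [w00|w0_neq0] := eqVneq w0 0.
  have yE : y = p y *: x by apply/eqP; rewrite -subr_eq0 -/w0 w00.
  have py1 : p y = 1 by move: y1; rewrite {1}yE normrZ x1 mulr1 ger0_norm.
  rewrite yE py1 scale1r -{1}[x]scale1r -scalerDl normrZ x1 mulr1 ger0_norm ?addr_ge0 //.
  exact: zeta_minus_le1D.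
have w0_gt0 : 0 < `|w0| by rewrite normr_gt0.
pose w := `|w0|^-1 *: w0.
have w1 : `|w| = 1 by rewrite normrZ normfV normr_id mulVf // gt_eqF.
have wx : quasi_orthogonal w x.
  apply: (quasi_orthogonal_of_support pN x1 px1).
  by rewrite /w linearZ /= pw0 scaler0.
have yE : y = `|w0| *: w + p y *: x.
  by rewrite /w scalerA divff ?gt_eqF // scale1r subrK.
apply: le_trans (zeta_minus_le_norm eps x1 w1 wx) _.
rewrite [in leRHS]yE; apply: norm_arc_ge => //.
- by move=> t; exact: quasi_orthogonal_norm_le.
- by rewrite -yE y1 w1.
Qed.

(** The gain of one greedy step. Convexity on the ray from [c] allows [v] to be
    shortened to norm [rho]; after division by [`|c|] the statement is
    [zeta_minus_le_supported] for the functional given by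
    [support_functional]. *)
Lemma norm_add_ge_zeta_minus (R : realType) (X : normedModType R) (c v : X)
    (rho : R) :
  c != 0 -> v != 0 -> (forall t : R, 0 <= t -> `|c| <= `|c + t *: v|) ->
  0 <= rho -> rho <= `|v| ->
  `|c| * zeta_minus X (rho / `|c|) <= `|c + v|.
Proof.
move=> c0 v0 cv rho0 rhov.
have cgt0 : 0 < `|c| by rewrite normr_gt0.
have vgt0 : 0 < `|v| by rewrite normr_gt0.
have [p [pN pc pv]] := support_functional cv.
pose x := `|c|^-1 *: c; pose y := `|v|^-1 *: v.
have x1 : `|x| = 1 by rewrite normrZ normfV normr_id mulVf // gt_eqF.
have y1 : `|y| = 1 by rewrite normrZ normfV normr_id mulVf // gt_eqF.
have px1 : p x = 1.
  by rewrite /x linearZ /= pc /GRing.scale /= mulVf // gt_eqF.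
have py0 : 0 <= p y.
  by rewrite /y linearZ /= /GRing.scale /= mulr_ge0 // invr_ge0.
have eps0 : 0 <= rho / `|c| by rewrite divr_ge0.
have := zeta_minus_le_supported pN x1 px1 y1 py0 eps0.
rewrite -(ler_pM2l cgt0) => /le_trans; apply.
have -> : `|c| * `|x + (rho / `|c|) *: y| = `|c + (rho / `|v|) *: v|.
  rewrite -[X in X * _]normr_id -normrZ scalerDr !scalerA divff ?gt_eqF //.
  by rewrite scale1r; congr (`|_ + _ *: _|); field; rewrite !gt_eqF.
rewrite -[in leRHS](scale1r v); apply: le_norm_along_ray; last exact: cv.
  by rewrite divr_ge0.
by rewrite ler_pdivrMr // mul1r.
Qed.

(** * Nearest points in uniformly convex spaces *)

(** The form of uniform convexity that makes minimizing sequences Cauchy: two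
    vectors of norm close to [d] whose midpoint has norm at least [d] are close.
    For [0 < d], scale by [m := d + eta <= 2 * d] into the unit ball; a distance
    of at least [e] would force [d <= (d + eta) * (1 - delta)], which fails for
    [eta <= d * delta / 2]. For [d = 0] both vectors are just small. *)
Lemma uniformly_convex_midpoint (R : realType) (X : normedModType R) (d e : R) :
  uniformly_convex X -> 0 <= d -> 0 < e ->
  exists2 eta : R, 0 < eta & forall x y : X,
    `|x| <= d + eta -> `|y| <= d + eta -> d <= `|x + y| / 2 -> `|x - y| < e.
Proof.
move=> ucX d0 e0.
have [d_eq0|d_neq0] := eqVneq d 0.
  exists (e / 3); first by rewrite divr_gt0.
  move=> x y xd yd _; apply: le_lt_trans (ler_normB _ _) _; lra.
have dgt0 : 0 < d by rewrite lt_neqAle eq_sym d_neq0.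
(* [modulus_convexity] is known to be positive on ]0, 2] only. *)
pose eps := Num.min (e / (2 * d)) 2.
have eps0 : 0 < eps by rewrite lt_min divr_gt0 ?mulr_gt0 /=.
have eps2 : eps <= 2 by rewrite ge_min lexx orbT.
pose delta := modulus_convexity X eps.
have delta0 : 0 < delta by exact: ucX.
have dd0 : 0 < d * delta by exact: mulr_gt0.
pose eta := Num.min d (d * delta / 2).
have eta0 : 0 < eta by rewrite lt_min dgt0 divr_gt0.
have etad : eta <= d by rewrite ge_min lexx.
have etadd : eta <= d * delta / 2 by rewrite ge_min lexx orbT.
exists eta => // x y xm ym dxy; rewrite ltNge; apply/negP => exy.
pose m := d + eta.
have m0 : 0 < m by rewrite addr_gt0.
have scaled z : `|z| <= m -> `|m^-1 *: z| <= 1.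
  by move=> zm; rewrite normrZ gtr0_norm ?invr_gt0 // mulrC ler_pdivrMr // mul1r.
have : delta <= 1 - `|m^-1 *: x + m^-1 *: y| / 2.
  apply: ge_inf.
    exists 0 => _ [u [w [u1 w1 _ ->]]]; rewrite subr_ge0 ler_pdivrMr // mul1r.
    by apply: le_trans (ler_normD _ _) _; apply: lerD.
  exists (m^-1 *: x), (m^-1 *: y); split=> //; [exact: scaled|exact: scaled|].
  rewrite -scalerBr normrZ gtr0_norm ?invr_gt0 // mulrC.
  apply: (@le_trans _ _ (e / (2 * d))); first by rewrite ge_min lexx.
  have d2 : 0 < 2 * d by rewrite mulr_gt0.
  apply: ler_pM => //; [exact: ltW|by rewrite invr_ge0 ltW|].
  by rewrite lef_pV2 ?posrE // /m; lra.
rewrite -scalerDr normrZ gtr0_norm ?invr_gt0 //.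
rewrite -(ler_pM2l m0) mulrBr mulr1 mulrA mulrA divff ?gt_eqF // mul1r => h.
have : 0 < eta * delta by exact: mulr_gt0.
move: h; rewrite /m mulrDl; lra.
Qed.

Lemma convex_set_comb (R : realType) (M : lmodType R) (A : set M) (x y : M)
    (t : R) :
  convex_set A -> A x -> A y -> 0 <= t -> t <= 1 -> A (t *: x + (1 - t) *: y).
Proof.
move=> cA Ax Ay t0 t1; have := cA x y (Itv01 t0 t1).
by rewrite !inE; apply.
Qed.

Lemma closure_normP (R : realType) (X : normedModType R) (A : set X) (x : X) :
  closure A x <-> forall e : R, 0 < e -> exists2 a, A a & `|x - a| < e.
Proof.
split=> [clx e e0|h B /nbhs_ballP[e /= e0 eB]].
  have [a [Aa]] := clx _ (nbhsx_ballx x e e0).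
  by rewrite -ball_normE /= => xa; exists a.
have [a Aa xa] := h e e0; exists a; split=> //; apply: eB.
by rewrite -ball_normE.
Qed.

Lemma convex_closure (R : realType) (X : normedModType R) (A : set X) :
  convex_set A -> convex_set (closure A).
Proof.
move=> cA x y l /[!inE] /closure_normP clx /closure_normP cly.
apply/closure_normP => e e0.
have [a Aa xa] := clx e e0; have [b Ab yb] := cly e e0.
exists (conv l (a : convex_lmodType X) b).
  by have := cA a b l; rewrite !inE; apply.
have l0 : 0 <= l%:num by [].
have l1 : 0 <= 1 - l%:num by rewrite subr_ge0.
have -> : conv l (x : convex_lmodType X) y - conv l (a : convex_lmodType X) b
    = l%:num *: (x - a) + (1 - l%:num) *: (y - b) :> X.
  by rewrite !scalerBr opprD addrACA.
apply: le_lt_trans (ler_normD _ _) _.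
rewrite (normrZ _ (x - a)) (normrZ _ (y - b)) !ger0_norm //.
have [l_eq0|l_neq0] := eqVneq (l%:num : R) 0; first by rewrite l_eq0; lra.
have lgt0 : 0 < l%:num :> R by rewrite lt_neqAle eq_sym l_neq0.
have := ler_wpM2l l1 (ltW yb); have : l%:num * `|x - a| < l%:num * e.
  by rewrite ltr_pM2l.
lra.
Qed.

(** A minimizing sequence [u] is Cauchy by [uniformly_convex_midpoint], since
    midpoints of points of [C] stay in [C]; its limit is the nearest point. *)
Lemma nearest_point (R : realType) (X : completeNormedModType R) (C : set X) :
  uniformly_convex X -> closed C -> convex_set C -> C !=set0 ->
  exists2 c, C c & forall y, C y -> `|c| <= `|y|.
Proof.
move=> ucX clC cC C0.
pose S := [set `|x| | x in C]; pose d := inf S.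
have S0 : S !=set0 by have [x Cx] := C0; exists `|x|, x.
have Slb : has_lbound S by exists 0 => _ [x _ <-].
have d0 : 0 <= d by apply: lb_le_inf => // _ [x _ <-].
have dle y : C y -> d <= `|y| by move=> Cy; apply: ge_inf => //; exists y.
have mid x y : C x -> C y -> d <= `|x + y| / 2.
  move=> Cx Cy; apply: (@le_trans _ _ `|2^-1 *: x + (1 - 2^-1) *: y|).
    by apply: dle; apply: convex_set_comb => //; lra.
  have -> : 1 - 2^-1 = 2^-1 :> R by lra.
  by rewrite -scalerDr normrZ gtr0_norm // mulrC.
have /choice[u uP] (n : nat) : exists x, C x /\ `|x| < d + n.+1%:R^-1.
  have n0 : 0 < n.+1%:R^-1 :> R by rewrite invr_gt0.
  have [_ [x Cx <-] xn] := inf_adherent n0 (conj S0 Slb).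
  by exists x.
have unear (e : R) : 0 < e -> \forall n \near \oo, `|u n| <= d + e.
  move=> e0; near=> n; have [_ /ltW un] := uP n; apply: le_trans un _.
  by rewrite lerD2l ltW //; near: n; exact: (near_infty_natSinv_lt (PosNum e0)).
have cu : cvg (u @ \oo).
  apply/cauchy_cvgP; apply: cauchy_exP => e e0.
  have [eta eta0 etaP] := uniformly_convex_midpoint ucX d0 e0.
  have [N _ NP] := unear eta eta0.
  exists (u N); exists N => // n /= Nn; rewrite -ball_normE /=.
  by apply: etaP; [by apply: NP => /=|exact: NP|apply: mid; [case: (uP N)|case: (uP n)]].
exists (lim (u @ \oo)).
  apply: (closed_cvg C clC _ (lim (u @ \oo)) cu).
  by near=> n; case: (uP n).
move=> y Cy; apply: le_trans (dle y Cy).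
apply/ler_addgt0Pr => e e0.
rewrite -(cvg_lim (@norm_hausdorff _ _) (cvg_norm cu)).
apply: limr_le; last exact: unear.
by apply: is_cvg_norm.
Unshelve. all: by end_near. Qed.

(** Up to [t = 1] the point [c + t *: (y - c)] is in [C]. For larger [t] it is
    beyond [y] on the ray, and a norm smaller than [`|c|] there would make the
    norm of [y], by convexity, smaller than [`|c|]. *)
Lemma nearest_point_ray (R : realType) (X : normedModType R) (C : set X)
    (c y : X) (t : R) :
  convex_set C -> C c -> C y -> (forall z, C z -> `|c| <= `|z|) -> 0 <= t ->
  `|c| <= `|c + t *: (y - c)|.
Proof.
move=> cC Cc Cy cmin t0.
have [t1|/ltW t1] := leP t 1.
  have -> : c + t *: (y - c) = t *: y + (1 - t) *: c.
    by rewrite scalerBr scalerBl scale1r addrCA.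
  by apply: cmin; exact: convex_set_comb.
have tgt0 : 0 < t by exact: lt_le_trans t1.
have tV0 : 0 <= t^-1 by rewrite invr_ge0.
have tV1 : 0 <= 1 - t^-1 by rewrite subr_ge0 invf_le1.
have : `|c| <= t^-1 * `|c + t *: (y - c)| + (1 - t^-1) * `|c|.
  apply: le_trans (cmin y Cy) _.
  have {1}-> : y = t^-1 *: (c + t *: (y - c)) + (1 - t^-1) *: c.
    rewrite scalerDr scalerA mulVf ?gt_eqF // scale1r scalerBl scale1r.
    by rewrite -addrA [y - c + _]addrA subrK addrC subrK.
  apply: le_trans (ler_normD _ _) _.
  by rewrite !(normrZ _ (_ + _)) (normrZ _ c) !ger0_norm.
move=> h; rewrite -subr_ge0 -(pmulr_rge0 _ (_ : 0 < t^-1)) ?invr_gt0 //; lra.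
Qed.

(** * The greedy construction *)

Lemma dist_le_closure (R : realType) (X : normedModType R) (x y : X)
    (A : set X) : closure A y -> dist x A <= `|x - y|.
Proof.
move=> /closure_normP cly; apply/ler_addgt0Pr => e e0.
have [a Aa ya] := cly e e0.
apply: (@le_trans _ _ `|x - a|).
  by apply: ge_inf; [exists 0 => _ [b _ <-]|exists a].
have := ler_normD (x - y) (y - a); rewrite addrA subrK; lra.
Qed.

Lemma supset_card (T : finType) (A : {set T}) (m : nat) :
  (#|A| <= m)%N -> (m <= #|T|)%N -> exists2 B : {set T}, A \subset B & #|B| = m.
Proof.
move=> /subnKC <-; elim: (m - #|A|)%N => [|l IH] h.
  by exists A; rewrite // addn0.
have [|B AB cB] := IH; first by apply: leq_trans h; rewrite addnS leqnSn.
have [i iB] : exists i, i \in ~: B.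
  by apply/card_gt0P; rewrite -(ltn_add2l #|B|) addn0 cardsC cB -addnS.
exists (i |: B); first exact: (fintype.subset_trans AB (finset.subsetUr _ _)).
by rewrite cardsU1 cB addnS; move: iB; rewrite inE => ->.
Qed.

Theorem theorem4p4 (R : realType) (X : completeNormedModType R)
    (dimX : dim_ge2 X) (ucX : uniformly_convex X)
    (r : nat -> R) (hr : associated_seq X r)
    (n k : nat) (k_ge1 : (1 <= k)%N) (k_le_n : (k <= n)%N)
    (K : 'I_n -> set X) (convK : forall i, convex_set (K i))
    (meetK : forall J : {set 'I_n}, #|J| = k ->
       (unit_ball X `&` \bigcap_(j in [set` J]) K j) !=set0) :
  exists x : X, forall i : 'I_n, dist x (K i) <= r k.
Proof.
have [r1 rS] := hr.
have rk0 : 0 <= r k.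
  case: k k_ge1 {k_le_n meetK} => // -[_|k _]; first by rewrite r1.
  by have [[]] := rS k.+1 isT.
apply: contrapT => far.
have farP x : exists i, r k < dist x (K i).
  apply: contrapT => near_x; apply: far; exists x => i; rewrite leNgt.
  by apply/negP => xi; apply: near_x; exists i.
pose C (J : {set 'I_n}) := \bigcap_(j in [set` J]) closure (K j).
have ballC (J : {set 'I_n}) : (#|J| <= k)%N -> exists2 y, `|y| <= 1 & C J y.
  move=> Jk; have kn : (k <= #|'I_n|)%N by rewrite card_ord.
  have [J' JJ' /meetK [y [y1 yK]]] := supset_card Jk kn.
  exists y => // j Jj; apply: subset_closure; apply: yK.
  exact: (fintype.subsetP JJ').
have convC (J : {set 'I_n}) : convex_set (C J).
  move=> x y l /[!inE] xC yC j Jj.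
  have := @convex_closure _ _ _ (convK j) x y l.
  by rewrite !inE; apply; [exact: xC|exact: yC].
have nearestC (J : {set 'I_n}) : (#|J| <= k)%N ->
    exists2 c, C J c & forall y, C J y -> `|c| <= `|y|.
  move=> Jk; apply: nearest_point => //.
  - by apply: closed_bigI => j _; exact: closed_closure.
  - by have [y _ Cy] := ballC J Jk; exists y.
have far_closure x i y : r k < dist x (K i) -> closure (K i) y -> r k < `|x - y|.
  by move=> xi Kiy; apply: lt_le_trans xi _; exact: dist_le_closure.
(* The bound on [#|J|] makes [ballC] applicable: it keeps [C J] nonempty, and for
   [j = k] it gives [`|c| <= 1]. *)
have greedy j : (1 <= j)%N -> (j <= k)%N -> exists (J : {set 'I_n}) c,
    [/\ (#|J| <= j)%N, C J c, forall y, C J y -> `|c| <= `|y|, 0 < `|c| &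
        r k / `|c| < r j].
  case: j => // j _; elim: j => [_|j IH jk].
    have [i i_far] := farP 0.
    have Ji : (#|[set i]%SET| <= k)%N by rewrite cards1.
    have [c Cc cmin] := nearestC _ Ji.
    have Kic : closure (K i) c by apply: Cc; rewrite /= inE.
    have c_far : r k < `|c| by have := far_closure _ _ _ i_far Kic; rewrite sub0r normrN.
    have c0 : 0 < `|c| by exact: le_lt_trans c_far.
    exists [set i]%SET, c; split=> //; first by rewrite cards1.
    by rewrite r1 ltr_pdivrMr // mul1r.
  have [J [c [Jj Cc cmin c0 cr]]] := IH (ltnW jk).
  have [i i_far] := farP c.
  have J'j : (#|(i |: J)%SET| <= j.+2)%N.
    by rewrite cardsU1; case: (i \notin J); rewrite ?add1n ?add0n ?ltnS // ltnW.
  have [c' C'c' c'min] := nearestC _ (leq_trans J'j jk).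
  have CC' y : C (i |: J)%SET y -> C J y.
    by move=> C'y l Jl; apply: C'y => /=; rewrite inE Jl orbT.
  have Kic' : closure (K i) c' by apply: C'c'; rewrite /= setU11.
  have cc' : `|c| <= `|c'| by apply: cmin; exact: CC'.
  have c'0 : 0 < `|c'| by exact: lt_le_trans cc'.
  have cc'_far : r k < `|c' - c| by rewrite distrC; exact: far_closure i_far Kic'.
  have cone (t : R) : 0 <= t -> `|c| <= `|c + t *: (c' - c)|.
    by apply: (nearest_point_ray (convC J)) => //; exact: CC'.
  have step : `|c| * zeta_minus X (r k / `|c|) <= `|c'|.
    rewrite -[X in _ <= `|X|](subrK c) addrC.
    apply: norm_add_ge_zeta_minus => //; last exact: ltW.
    - by rewrite -normr_gt0.
    - by rewrite -normr_gt0; exact: le_lt_trans cc'_far.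
  exists (i |: J)%SET, c'; split=> //.
  (* With [s := r k / `|c|] and [s' := r k / `|c'|], the assumption [r j.+2 <= s']
     gives [r j.+1 = r j.+2 * zeta_minus X (r j.+2) <= s' * zeta_minus X s <= s],
     against [s < r j.+1]. *)
  rewrite ltNge; apply/negP => rs.
  have [[rj0 rjE] _] := rS j.+1 isT.
  have : r j.+1 <= r k / `|c|; last by rewrite leNgt cr.
  rewrite -rjE.
  have s'0 : 0 <= r k / `|c'| by rewrite divr_ge0.
  have s's : r k / `|c'| <= r k / `|c| by rewrite ler_wpM2l // lef_pV2.
  apply: (@le_trans _ _ (r k / `|c'| * zeta_minus X (r k / `|c|))).
    apply: ler_pM => //; first exact: zeta_minus_ge0.
    by apply: zeta_minus_nondecreasing => //; exact: le_trans s's.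
  rewrite mulrAC -mulrA ler_wpM2l // ler_pdivrMr // ler_pdivlMl //.
have [J [c [Jk Cc cmin c0]]] := greedy k k_ge1 (leqnn k).
rewrite ltNge => /negP; apply.
have [y y1 Cy] := ballC J Jk.
by rewrite ler_pdivlMr // ler_piMr // (le_trans (cmin y Cy)).
Qed.
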